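(* There exists a function $f_0\colon\mathbb{N}\to\{+1,-1\}$ with the following property: for Lebesgue-almost every $\alpha>1$ there is a constant $c_\alpha>0$ such that \[ S_\alpha(f_0,x)-\alpha^{-1}S(f_0,x)\ \ge\ c_\alpha\,\|f_0|_x\|_2\,\sqrt{\log\log x} \] holds for infinitely many $x\in\mathbb{N}$.
   Context: $\mathbb{N}=\{1,2,3,\dots\}$, $\lfloor \xi\rfloor$ is the integer part of $\xi$, and $\mathcal{B}(\alpha)=\{\lfloor n\alpha\rfloor : n\in\mathbb{N}\}$ for real $\alpha\ge1$. For $x\ge1$: $S_\alpha(f,x)=\sum_{1\le m\le x,\ m\in\mathcal{B}(\alpha)} f(m)$, $S(f,x)=\sum_{1\le m\le x} f(m)$, and $\|f|_x\|_2=\big(\sum_{1\le m\le x}|f(m)|^2\big)^{1/2}$ (so $\|f_0|_x\|_2=\sqrt{\lfloor x\rfloor}$ here). *)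

(* Defs.v *)
From Stdlib Require Import Reals Lra Lia ZArith Classical ClassicalEpsilon.
Open Scope R_scope.

Definition in_beatty (alpha : R) (m : nat) : Prop :=
  exists n : nat, (1 <= n)%nat /\ Int_part (INR n * alpha) = Z.of_nat m.

Fixpoint sum_to (g : nat -> R) (x : nat) : R :=
  match x with
  | O => 0
  | S k => sum_to g k + g (S k)
  end.

Definition ind (P : Prop) : R :=
  if excluded_middle_informative P then 1 else 0.

Definition S_alpha (alpha : R) (f : nat -> R) (x : nat) : R :=
  sum_to (fun m => ind (in_beatty alpha m) * f m) x.

Definition S_full (f : nat -> R) (x : nat) : R := sum_to f x.

Definition norm2_upto (f : nat -> R) (x : nat) : R :=
  sqrt (sum_to (fun m => (f m)^2) x).

Definition null_set (E : R -> Prop) : Prop :=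
  forall eps : R, eps > 0 ->
    exists a b : nat -> R,
      (forall n, a n <= b n) /\
      (forall t, E t -> exists n, a n <= t <= b n) /\
      (forall N, sum_f_R0 (fun n => b n - a n) N <= eps).

(* Main.v *)
(** Write [a_m = 1_B(m) - 1/alpha], so that the left-hand side is the walk
    [sum_(m <= x) a_m f0(m)]; all that matters about the Beatty sequence is that
    [sigma <= |a_m| <= 1] with [sigma = (1/alpha)(1 - 1/alpha)].

    For random signs and a large parameter [r], follow the walk along
    [x' = x (1 + r 64^r)] for [64^r] blocks.  Cut each block into [r] sub-blocks
    of length [n]: a fourth-moment argument shows that each of them gains
    [sigma sqrt n / 5] with probability at least [1/32], so the whole block gains
    [sigma r sqrt n / 5] with probability at least [32^-r].  Blocks are so much
    longer than their past that Chebyshev's inequality makes the past harmless,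
    hence with probability [1 - O(1/r)] some block end [x] satisfies
    [walk >= sigma r sqrt n / 10], which is of order [sigma sqrt (x log log x)]
    because [log log x = O(r)] throughout.

    Averaging over [alpha] in a fine finite grid of a compact interval yields a
    single sign pattern that works for all [alpha] outside finitely many
    intervals of small total length.  Iterating along an exhaustion of
    [(1, oo)] with summable lengths, an exceptional [alpha] lies in the
    exceptional intervals of all late stages. *)

From Stdlib Require Import Reals Lra Lia ZArith List Classical ClassicalEpsilon.
Require Import Defs.
Open Scope R_scope.

(** * Random walks with prescribed step sizes *)

Lemma ind_true (P : Prop) : P -> ind P = 1.
Proof. intros H. unfold ind. now destruct excluded_middle_informative. Qed.

Lemma ind_false (P : Prop) : ~ P -> ind P = 0.
Proof. intros H. unfold ind. now destruct excluded_middle_informative. Qed.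

Lemma ind_bounds (P : Prop) : 0 <= ind P <= 1.
Proof. unfold ind. destruct excluded_middle_informative; lra. Qed.

(* The quartic [y (y + 2)^2 (4 - y) = 16 y + 12 y^2 - y^4] is a lower test
   function for the event [y >= 1/5]. *)
Lemma quartic_test (y : R) :
  16 * y + 12 * y^2 - y^4 - 9 / 2 <= 144 * ind (1 / 5 <= y).
Proof.
  assert (E : 16 * y + 12 * y^2 - y^4 = (y * (4 - y)) * (y + 2)^2) by ring.
  assert (Hsq : 0 <= (y + 2)^2) by apply pow2_ge_0.
  assert (Hneg : y * (4 - y) <= 0 -> (y * (4 - y)) * (y + 2)^2 <= 0).
  { intros H. apply Rmult_le_compat_r with (r := (y + 2)^2) in H; lra. }
  rewrite E. clear E.
  destruct (Rle_lt_dec (1 / 5) y) as [H|H].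
  - rewrite ind_true by assumption.
    destruct (Rle_lt_dec y 4).
    + assert ((y * (4 - y)) * (y + 2)^2 <= 4 * 36); [|lra].
      pose proof (pow2_ge_0 (y - 2)). clear Hneg.
      apply Rmult_le_compat; nra.
    + assert (y * (4 - y) <= 0) by nra. lra.
  - rewrite ind_false by lra.
    destruct (Rle_lt_dec y 0).
    + assert (y * (4 - y) <= 0) by nra. lra.
    + assert (y * y <= / 5 * y) by (apply Rmult_le_compat_r; lra).
      assert ((y * (4 - y)) * (y + 2)^2 <= 4 / 5 * (46 / 9)); [|lra].
      apply Rmult_le_compat; nra.
Qed.

Section Walk.

Variable a : nat -> R.

(** The expectation of [phi] at the end of a walk from [u] with fair independent signs on the steps
    [a (M+1), ..., a (M+n)]. Conditioning on the first sign gives a finite recursion, so no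
    probability space is needed. *)
Fixpoint law (M n : nat) (phi : R -> R) (u : R) : R :=
  match n with
  | O => phi u
  | S k => (law (S M) k phi (u + a (S M)) + law (S M) k phi (u - a (S M))) / 2
  end.

Fixpoint qvar (M n : nat) : R :=
  match n with
  | O => 0
  | S k => (a (S M))^2 + qvar (S M) k
  end.

Lemma law_le (n : nat) : forall M phi psi u,
  (forall v, phi v <= psi v) -> law M n phi u <= law M n psi u.
Proof.
  induction n as [|n IH]; intros M phi psi u H; simpl; [apply H|].
  pose proof (IH (S M) phi psi (u + a (S M)) H).
  pose proof (IH (S M) phi psi (u - a (S M)) H). lra.
Qed.

Lemma law_lin (n : nat) : forall M phi psi c d e u,
  law M n (fun v => c * phi v + d * psi v + e) u
  = c * law M n phi u + d * law M n psi u + e.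
Proof.
  induction n as [|n IH]; intros; simpl; [reflexivity|].
  rewrite !IH. lra.
Qed.

Lemma law_add (n1 n2 : nat) : forall M phi u,
  law M (n1 + n2) phi u = law M n1 (law (M + n1) n2 phi) u.
Proof.
  induction n1 as [|n1 IH]; intros; simpl.
  - now rewrite Nat.add_0_r.
  - rewrite !IH. now replace (S M + n1)%nat with (M + S n1)%nat by lia.
Qed.

Lemma law_id (n : nat) : forall M u, law M n (fun v => v) u = u.
Proof.
  induction n as [|n IH]; intros M u; simpl; [reflexivity|].
  rewrite !IH. lra.
Qed.

Lemma law_sqr (n : nat) : forall M u,
  law M n (fun v => v^2) u = u^2 + qvar M n.
Proof.
  induction n as [|n IH]; intros M u; cbn [law qvar]; [lra|].
  rewrite !IH. field.
Qed.

(** The Gaussian value of the fourth moment is an upper bound: after averaging over the first step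
    [b], the induction closes with slack [2 b^4]. *)
Lemma law_quartic (n : nat) : forall M u,
  law M n (fun v => v^4) u <= u^4 + 6 * u^2 * qvar M n + 3 * (qvar M n)^2.
Proof.
  induction n as [|n IH]; intros M u; cbn [law qvar]; [lra|].
  pose proof (IH (S M) (u + a (S M))) as H1.
  pose proof (IH (S M) (u - a (S M))) as H2.
  set (s := qvar (S M) n) in *. set (b := a (S M)) in *.
  assert (0 <= (b^2)^2) by apply pow2_ge_0.
  nra.
Qed.

Variable sigma : R.
Hypothesis sigma_pos : 0 < sigma.
Hypothesis a_lower : forall m, sigma <= Rabs (a m).
Hypothesis a_upper : forall m, Rabs (a m) <= 1.

Lemma qvar_lower (n : nat) : forall M, INR n * sigma^2 <= qvar M n.
Proof.
  induction n as [|n IH]; intros M; [simpl; lra|].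
  rewrite S_INR. cbn [qvar]. specialize (IH (S M)).
  pose proof (a_lower (S M)) as H. rewrite <- (pow2_abs (a (S M))). nra.
Qed.

Lemma qvar_upper (n : nat) : forall M, qvar M n <= INR n.
Proof.
  induction n as [|n IH]; intros M; [simpl; lra|].
  rewrite S_INR. cbn [qvar]. specialize (IH (S M)).
  pose proof (a_upper (S M)) as H. pose proof (Rabs_pos (a (S M))).
  rewrite <- (pow2_abs (a (S M))). nra.
Qed.

Lemma law_shift (n : nat) : forall M phi u w,
  law M n phi (u + w) = law M n (fun v => phi (v + w)) u.
Proof.
  induction n as [|n IH]; intros; simpl; [reflexivity|].
  rewrite <- !IH. f_equal. f_equal; f_equal; ring.
Qed.

(** Apply [quartic_test] to the increment divided by its standard deviation [t]. The moments 0, 1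
    and at most 3 give the quartic mean at least [12 - 3 - 9/2 = 9/2], and [(9/2) / 144 = 1/32]. *)
Lemma law_gain (M n : nat) (u : R) : (1 <= n)%nat ->
  / 32 <= law M n (fun v => ind (u + sigma * sqrt (INR n) / 5 <= v)) u.
Proof.
  intros Hn.
  assert (Hn' : 1 <= INR n) by (apply (le_INR 1); lia).
  set (s := qvar M n).
  assert (Hs : INR n * sigma^2 <= s) by apply qvar_lower.
  assert (Hs0 : 0 < s) by nra.
  set (t := sqrt s).
  assert (Ht : 0 < t) by now apply sqrt_lt_R0.
  assert (Htt : t^2 = s) by (apply pow2_sqrt; lra).
  assert (Hlow : sigma * sqrt (INR n) <= t).
  { rewrite <- (sqrt_pow2 sigma) by lra. rewrite <- sqrt_mult by nra.
    apply sqrt_le_1_alt. lra. }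
  (* Recentre at 0, where the first moment vanishes and [law_quartic] reduces to [3 s^2]. *)
  rewrite <- (Rplus_0_l u) at 1. rewrite law_shift.
  set (q := fun v => 16 * (v / t) + 12 * (v / t)^2 - (v / t)^4 - 9 / 2).
  apply Rle_trans with (law M n (fun v => / 144 * q v) 0).
  - apply Rle_trans with (/ 144 * (9 / 2)); [lra|].
    assert (E : law M n (fun v => / 144 * q v) 0
       = / 144 * (12 / t^2 * s - / t^4 * law M n (fun v => v^4) 0 - 9 / 2)).
    { transitivity (law M n (fun v =>
        / 144 * (16 / t) * v + 1 * (/ 144 * (12 / t^2) * v^2
          + - (/ 144 * / t^4) * v^4 + - (/ 144 * (9 / 2))) + 0) 0).
      - assert (G : forall phi psi, (forall v, phi v = psi v) ->
          law M n phi 0 = law M n psi 0).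
        { intros phi psi G. apply Rle_antisym; apply law_le; intros v;
          rewrite G; lra. }
        apply G. intros v. unfold q. field. lra.
      - rewrite (law_lin n M (fun v => v)). rewrite (law_lin n M (fun v => v^2)).
        rewrite law_id, law_sqr. fold s. field. lra. }
    rewrite E.
    pose proof (law_quartic n M 0) as H4. fold s in H4.
    assert (H4' : law M n (fun v => v^4) 0 <= 3 * (t^2)^2) by (rewrite Htt; lra).
    assert (/ t^4 * law M n (fun v => v^4) 0 <= 3).
    { apply Rmult_le_reg_l with (t^4); [now apply pow_lt|].
      rewrite <- Rmult_assoc, Rinv_r by (apply pow_nonzero; lra). lra. }
    replace (12 / t^2 * s) with 12 by (rewrite Htt; field; lra). lra.
  - apply law_le. intros v.
    pose proof (quartic_test (v / t)) as H. unfold q.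
    enough (ind (1 / 5 <= v / t) <= ind (u + sigma * sqrt (INR n) / 5 <= v + u)) by lra.
    destruct (Rle_lt_dec (1 / 5) (v / t)) as [H1|H1].
    + rewrite (ind_true (u + _ <= _)); [apply ind_bounds|].
      apply Rmult_le_compat_r with (r := t) in H1; [|lra].
      unfold Rdiv in H1 at 2. rewrite Rmult_assoc, Rinv_l, Rmult_1_r in H1 by lra. lra.
    + rewrite ind_false by lra. apply ind_bounds.
Qed.

(* Large deviations by insisting that each of [r] consecutive sub-blocks gains
   one standard deviation. *)
Lemma law_large_gain (n : nat) (Hn : (1 <= n)%nat) (r : nat) : forall M u T,
  T <= u + INR r * (sigma * sqrt (INR n) / 5) ->
  (/ 32)^r <= law M (r * n) (fun v => ind (T <= v)) u.
Proof.
  induction r as [|r IH]; intros M u T HT.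
  - simpl in *. rewrite ind_true by lra. lra.
  - rewrite S_INR in HT. simpl Nat.mul. rewrite law_add. simpl pow.
    assert (Hp : 0 < (/ 32)^r) by (apply pow_lt; lra).
    (* Keep only the paths whose first sub-block gains enough; the induction hypothesis restarts
       from their end point. The zero terms merely fit the shape of [law_lin]. *)
    apply Rle_trans with (law M n (fun v =>
      (/ 32)^r * ind (u + sigma * sqrt (INR n) / 5 <= v) + 0 * 0 + 0) u).
    + rewrite (law_lin n M _ (fun _ => 0)).
      pose proof (law_gain M n u Hn). nra.
    + apply law_le. intros v.
      destruct (Rle_lt_dec (u + sigma * sqrt (INR n) / 5) v) as [H|H].
      * rewrite ind_true by assumption.
        apply Rle_trans with ((/ 32)^r); [lra|]. apply IH. lra.
      * rewrite ind_false by lra.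
        apply Rle_trans with (law (M + n) (r * n) (fun _ => 0 * 0 + 0 * 0 + 0) v).
        -- rewrite (law_lin (r * n) (M + n) (fun _ => 0) (fun _ => 0)). lra.
        -- apply law_le. intros w. pose proof (ind_bounds (T <= w)). lra.
Qed.

Variables r rho : nat.
Hypothesis r_pos : (1 <= r)%nat.
Hypothesis rho_pos : (1 <= rho)%nat.

Definition next (x : nat) : nat := (x + r * (rho * x))%nat.

(** Half of the gain [r sigma sqrt n / 5] of a successful block; the other half compensates for a
    start as low as [- level x]. *)
Definition level (x : nat) : R := sigma * INR r * sqrt (INR (rho * x)) / 10.

(** The probability that [b] successive block ends all stay below their thresholds. The threshold is
    indexed by the start of the block. *)
Fixpoint miss_prob (b x : nat) (u : R) : R :=
  match b with
  | O => 1
  | S k => law x (r * (rho * x))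
             (fun v => ind (v < level x) * miss_prob k (next x) v) u
  end.

Lemma miss_prob_bounds (b : nat) : forall x u, 0 <= miss_prob b x u <= 1.
Proof.
  induction b as [|b IH]; intros x u; simpl; [lra|].
  assert (C : forall e, law x (r * (rho * x)) (fun _ => 0 * 0 + 0 * 0 + e) u = e).
  { intros e. rewrite (law_lin _ x (fun _ => 0) (fun _ => 0)). lra. }
  split; [rewrite <- (C 0) at 1|rewrite <- (C 1)]; apply law_le; intros v;
    pose proof (ind_bounds (v < level x)); specialize (IH (next x) v); nra.
Qed.

Lemma INR_next (x : nat) : INR (next x) = INR x + INR r * (INR rho * INR x).
Proof. unfold next. now rewrite plus_INR, !mult_INR. Qed.

(* The term [u^2 / x] pays for starting below [- level x] (Chebyshev);
   in one block its expectation grows by at most one. *)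
Lemma miss_prob_le (b : nat) : forall x u, (1 <= x)%nat ->
  miss_prob b x u <= (1 - (/ 32)^r)^b
    + 100 / (sigma^2 * (INR r)^2 * INR rho) * (u^2 / INR x + INR b).
Proof.
  set (K := 100 / (sigma^2 * (INR r)^2 * INR rho)).
  assert (Hr : 1 <= INR r) by (apply (le_INR 1); lia).
  assert (Hrho : 1 <= INR rho) by (apply (le_INR 1); lia).
  assert (HK : 0 < K).
  { apply Rdiv_lt_0_compat; [lra|]. apply Rmult_lt_0_compat; [|lra].
    apply Rmult_lt_0_compat; apply pow_lt; lra. }
  assert (Hp : 0 < (/ 32)^r <= 1).
  { split; [apply pow_lt; lra|]. rewrite <- (pow1 r). apply pow_incr. lra. }
  induction b as [|b IH]; intros x u Hx.
  - simpl. assert (1 <= INR x) by (apply (le_INR 1); lia).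
    assert (0 <= u^2 / INR x) by (apply Rmult_le_pos; [nra|left; apply Rinv_0_lt_compat; lra]).
    simpl in *. nra.
  - assert (Hx' : 1 <= INR x) by (apply (le_INR 1); lia).
    assert (Hu : 0 <= u^2 / INR x) by (apply Rmult_le_pos; [nra|left; apply Rinv_0_lt_compat; lra]).
    assert (Hq : 0 <= (1 - (/ 32)^r)^b) by (apply pow_le; lra).
    assert (Hb : 0 <= INR b) by apply pos_INR.
    rewrite S_INR.
    set (n := (rho * x)%nat).
    assert (En : INR n = INR rho * INR x) by apply mult_INR.
    assert (Hn : (1 <= n)%nat) by (unfold n; nia).
    assert (Hn' : 1 <= INR n) by (apply (le_INR 1); lia).
    destruct (Rlt_le_dec u (- level x)) as [Hl|Hl].
    + apply Rle_trans with 1; [apply miss_prob_bounds|].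
      assert (H1 : 1 <= K * (u^2 / INR x)).
      { assert (Hlev : 0 <= level x).
        { unfold level. fold n. pose proof (sqrt_pos (INR n)).
          apply Rmult_le_pos; [|lra]. apply Rmult_le_pos; [nra|assumption]. }
        assert (Hlu : (level x)^2 <= u^2) by nra.
        (* [K] is chosen for this identity: below [- level x] the Chebyshev term alone is at least
           1. *)
        assert (Elev : (level x)^2 = INR x / K).
        { unfold level. fold n.
          transitivity (sigma^2 * INR r^2 * (sqrt (INR n))^2 / 100); [field|].
          rewrite pow2_sqrt by lra. rewrite En. unfold K. field.
          repeat split; try lra. }
        rewrite Elev in Hlu.
        replace 1 with (K * (INR x / K / INR x)) by (field; lra).
        apply Rmult_le_compat_l; [lra|]. apply Rmult_le_compat_r; [|assumption].
        left. apply Rinv_0_lt_compat. lra. }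
      assert (0 <= (1 - (/ 32)^r)^S b) by (apply pow_le; lra). nra.
    + cbn [miss_prob]. fold n.
      set (x' := next x).
      assert (Ex' : INR x' = INR x + INR r * INR n) by (unfold x'; rewrite INR_next, En; ring).
      assert (Hxx : INR x <= INR x') by nra.
      set (q := (1 - (/ 32)^r)^b) in *.
      (* Bounding the later blocks by induction leaves a combination of an indicator and a square,
         whose expectations are controlled by [law_large_gain] and [law_sqr]. *)
      apply Rle_trans with (law x (r * n) (fun v =>
         - q * ind (level x <= v) + K / INR x' * v^2 + (q + K * INR b)) u).
      * apply law_le. intros v.
        assert (Hv : 0 <= v^2 / INR x') by (apply Rmult_le_pos; [nra|left; apply Rinv_0_lt_compat; lra]).
        pose proof (miss_prob_bounds b x' v).
        assert (Hx1 : (1 <= x')%nat) by (unfold x', next; lia).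
        pose proof (IH x' v Hx1) as IHv. fold q in IHv.
        replace (K / INR x' * v^2) with (K * (v^2 / INR x')) by (field; lra).
        destruct (Rlt_le_dec v (level x)) as [Hv1|Hv1].
        -- rewrite (ind_true (v < _)), (ind_false (_ <= v)) by lra. lra.
        -- rewrite (ind_false (v < _)), (ind_true (_ <= v)) by lra. nra.
      * rewrite law_lin, law_sqr.
        pose proof (qvar_upper (r * n) x) as Hs. rewrite mult_INR in Hs.
        assert (HT : level x <= u + INR r * (sigma * sqrt (INR n) / 5)).
        { unfold level in *. fold n in Hl |- *. lra. }
        pose proof (law_large_gain n Hn r x u (level x) HT) as HG.
        assert (Hm : K / INR x' * (u^2 + qvar x (r * n)) <= K * (u^2 / INR x + 1)).
        { replace (K / INR x' * (u^2 + qvar x (r * n)))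
            with (K * (u^2 / INR x' + qvar x (r * n) / INR x')) by (field; lra).
          apply Rmult_le_compat_l; [lra|]. apply Rplus_le_compat.
          - apply Rmult_le_compat_l; [nra|]. apply Rinv_le_contravar; lra.
          - apply Rmult_le_reg_r with (INR x'); [lra|].
            unfold Rdiv. rewrite Rmult_assoc, Rinv_l by lra. lra. }
        apply Rmult_le_compat_l with (r := q) in HG; [|assumption].
        rewrite <- (tech_pow_Rmult _ b). fold q. lra.
Qed.

End Walk.

(** * Averages over sign patterns *)

Definition walk (a f : nat -> R) (x : nat) : R := sum_to (fun m => a m * f m) x.

Definition upd (f : nat -> R) (m : nat) (v : R) : nat -> R :=
  fun k => if Nat.eqb k m then v else f k.

Definition signs (f : nat -> R) : Prop := forall m, f m = 1 \/ f m = -1.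

Definition agree (M : nat) (f f' : nat -> R) : Prop :=
  forall m, (m <= M)%nat -> f' m = f m.

(** The counterpart of [law] on sign patterns: walks for different [alpha] share the same signs, so
    a joint average must run over the patterns themselves. *)
Fixpoint avg (M n : nat) (g : (nat -> R) -> R) (f : nat -> R) : R :=
  match n with
  | O => g f
  | S k => (avg (S M) k g (upd f (S M) 1) + avg (S M) k g (upd f (S M) (-1))) / 2
  end.

Lemma sum_to_ext (g h : nat -> R) (x : nat) :
  (forall m, (1 <= m <= x)%nat -> g m = h m) -> sum_to g x = sum_to h x.
Proof.
  induction x as [|x IH]; intros H; simpl; [reflexivity|].
  rewrite IH by (intros; apply H; lia). now rewrite (H (S x)) by lia.
Qed.

Lemma walk_agree (a f f' : nat -> R) (x M : nat) :
  (x <= M)%nat -> agree M f f' -> walk a f' x = walk a f x.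
Proof.
  intros Hx H. apply sum_to_ext. intros m Hm. now rewrite H by lia.
Qed.

Lemma agree_upd (f : nat -> R) (M : nat) (v : R) : agree M f (upd f (S M) v).
Proof.
  intros m Hm. unfold upd. destruct (Nat.eqb_spec m (S M)); [lia|reflexivity].
Qed.

Lemma agree_trans (M M' : nat) (f g h : nat -> R) :
  (M <= M')%nat -> agree M f g -> agree M' g h -> agree M f h.
Proof. intros HM H1 H2 m Hm. now rewrite H2, H1 by lia. Qed.

Lemma agree_upd_trans (f f' : nat -> R) (M : nat) (v : R) :
  agree (S M) (upd f (S M) v) f' -> agree M f f'.
Proof. apply agree_trans; [lia|apply agree_upd]. Qed.

Lemma signs_upd (f : nat -> R) (M : nat) (v : R) :
  signs f -> v = 1 \/ v = -1 -> signs (upd f M v).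
Proof. intros H Hv m. unfold upd. destruct (Nat.eqb m M); auto. Qed.

Lemma avg_ext (n : nat) : forall M g h f,
  (forall f', agree M f f' -> g f' = h f') -> avg M n g f = avg M n h f.
Proof.
  induction n as [|n IH]; intros M g h f H; simpl.
  - apply H. now intros m _.
  - f_equal. f_equal; apply IH; intros f' Hf'; apply H;
      eapply agree_upd_trans; eassumption.
Qed.

Lemma avg_add (n1 n2 : nat) : forall M g f,
  avg M (n1 + n2) g f = avg M n1 (avg (M + n1) n2 g) f.
Proof.
  induction n1 as [|n1 IH]; intros; simpl.
  - now rewrite Nat.add_0_r.
  - rewrite !IH. now replace (S M + n1)%nat with (M + S n1)%nat by lia.
Qed.

Lemma avg_scal (n : nat) : forall M c g f,
  avg M n (fun f' => c * g f') f = c * avg M n g f.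
Proof.
  induction n as [|n IH]; intros; simpl; [reflexivity|]. rewrite !IH. lra.
Qed.

Definition rsum (l : list R) : R := fold_right Rplus 0 l.

Lemma avg_rsum {A : Type} (l : list A) (g : A -> (nat -> R) -> R) (n : nat) :
  forall M f,
  avg M n (fun f' => rsum (map (fun i => g i f') l)) f
  = rsum (map (fun i => avg M n (g i) f) l).
Proof.
  induction n as [|n IH]; intros; simpl; [reflexivity|].
  rewrite !IH. clear IH. induction l as [|i l IHl]; simpl in *; lra.
Qed.

(** The first-moment method: the smaller of two values is at most their mean, sign by sign. The
    values up to [M] stay fixed, so successive stages are compatible. *)
Lemma avg_attained (n : nat) : forall M g f, signs f ->
  exists f', signs f' /\ agree M f f' /\ g f' <= avg M n g f.
Proof.
  induction n as [|n IH]; intros M g f Hf; simpl.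
  - exists f. repeat split; try assumption; lra.
  - destruct (IH (S M) g (upd f (S M) 1)) as (f1 & S1 & A1 & L1);
      [apply signs_upd; auto|].
    destruct (IH (S M) g (upd f (S M) (-1))) as (f2 & S2 & A2 & L2);
      [apply signs_upd; auto|].
    apply agree_upd_trans in A1, A2.
    destruct (Rle_lt_dec (g f1) (g f2)).
    + exists f1. repeat split; try assumption; lra.
    + exists f2. repeat split; try assumption; lra.
Qed.

Lemma avg_law (a : nat -> R) (phi : R -> R) (n : nat) : forall M f,
  avg M n (fun f' => phi (walk a f' (M + n))) f = law a M n phi (walk a f M).
Proof.
  induction n as [|n IH]; intros M f; cbn [avg law].
  - now rewrite Nat.add_0_r.
  - replace (M + S n)%nat with (S M + n)%nat by lia. rewrite !IH.
    assert (E : forall v, walk a (upd f (S M) v) (S M) = walk a f M + a (S M) * v).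
    { intros v. unfold walk at 1. cbn [sum_to].
      change (walk a (upd f (S M) v) M + a (S M) * upd f (S M) v (S M)
              = walk a f M + a (S M) * v).
      rewrite (walk_agree a f (upd f (S M) v) M M) by (auto using agree_upd).
      unfold upd at 1. now rewrite Nat.eqb_refl. }
    rewrite !E. f_equal. f_equal; f_equal; ring.
Qed.

Section Miss.

Variables (a : nat -> R) (sigma : R) (r rho : nat).

Fixpoint miss (b x : nat) (f : nat -> R) : R :=
  match b with
  | O => 1
  | S k => ind (walk a f (next r rho x) < level sigma r rho x)
           * miss k (next r rho x) f
  end.

Fixpoint final (b x : nat) : nat :=
  match b with
  | O => x
  | S k => final k (next r rho x)
  end.

Lemma final_ge (b : nat) : forall x, (x <= final b x)%nat.
Proof.
  induction b as [|b IH]; intros x; simpl; [lia|].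
  specialize (IH (next r rho x)). unfold next in *. lia.
Qed.

(** Split the average at the first block end. The indicator there does not depend on later signs and
    factors out of the inner average. *)
Lemma avg_miss (b : nat) : forall x f,
  avg x (final b x - x) (miss b x) f = miss_prob a sigma r rho b x (walk a f x).
Proof.
  induction b as [|b IH]; intros x f.
  - simpl. now rewrite Nat.sub_diag.
  - cbn [final miss_prob].
    set (x' := next r rho x). pose proof (final_ge b x') as Hge.
    set (n := (r * (rho * x))%nat).
    assert (Ex : x' = (x + n)%nat) by reflexivity.
    replace (final b x' - x)%nat with (n + (final b x' - x'))%nat by lia.
    rewrite avg_add, <- Ex, <- avg_law.
    apply avg_ext. intros f1 _. rewrite <- Ex, <- IH, <- avg_scal.
    apply avg_ext. intros f2 H2. cbn [miss]. fold x'.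
    now rewrite (walk_agree a f1 f2 x' x').
Qed.

(** As a product of indicators, [miss] differs from 1 only if some block end reaches its level. *)
Lemma miss_cases (b : nat) : forall x f, (1 <= x)%nat ->
  miss b x f = 1 \/
  exists y, (x <= y)%nat /\ (next r rho y <= final b x)%nat /\
            level sigma r rho y <= walk a f (next r rho y).
Proof.
  induction b as [|b IH]; intros x f Hx; [now left|].
  cbn [miss final].
  assert (Hn : (x <= next r rho x)%nat) by (unfold next; lia).
  destruct (Rlt_le_dec (walk a f (next r rho x)) (level sigma r rho x)) as [H|H].
  - rewrite ind_true by assumption.
    destruct (IH (next r rho x) f) as [E|(y & H1 & H2 & H3)]; [lia| |].
    + left. rewrite E. lra.
    + right. exists y. repeat split; try assumption; lia.
  - right. exists x. repeat split; [lia|apply final_ge|assumption].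
Qed.

Lemma miss_nonneg (b : nat) : forall x f, 0 <= miss b x f.
Proof.
  induction b as [|b IH]; intros x f; cbn [miss]; [lra|].
  apply Rmult_le_pos; [apply ind_bounds|apply IH].
Qed.

Lemma INR_final (b : nat) : forall x,
  INR (final b x) = INR x * (1 + INR r * INR rho)^b.
Proof.
  induction b as [|b IH]; intros x; simpl; [lra|].
  rewrite IH, INR_next. ring.
Qed.

End Miss.

Lemma walk_abs_le (a f : nat -> R) (x : nat) :
  (forall m, Rabs (a m) <= 1) -> signs f -> Rabs (walk a f x) <= INR x.
Proof.
  intros Ha Hf. unfold walk. induction x as [|x IH]; [simpl; rewrite Rabs_R0; lra|].
  rewrite S_INR. cbn [sum_to]. eapply Rle_trans; [apply Rabs_triang|].
  apply Rplus_le_compat; [exact IH|]. rewrite Rabs_mult.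
  specialize (Ha (S x)).
  destruct (Hf (S x)) as [-> | ->]; [rewrite Rabs_R1|rewrite (Rabs_left (-1)) by lra]; lra.
Qed.

Lemma INR_le_pow (c : R) (r : nat) : 2 <= c -> INR r <= c^r.
Proof.
  intros Hc. induction r as [|r IH]; [simpl; lra|].
  rewrite S_INR. simpl. assert (1 <= c^r) by (apply pow_R1_Rle; lra). nra.
Qed.

Lemma INR_64_pow (r : nat) : INR (64^r) = 64^r.
Proof.
  rewrite pow_INR. f_equal. simpl. lra.
Qed.

Lemma exp_INR_mult (n : nat) (c : R) : exp (INR n * c) = exp c ^ n.
Proof.
  induction n as [|n IH]; [simpl; now rewrite Rmult_0_l, exp_0|].
  rewrite S_INR, Rmult_plus_distr_r, Rmult_1_l, exp_plus, IH. simpl. ring.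
Qed.

Lemma ln_le (x y : R) : 0 < x -> x <= y -> ln x <= ln y.
Proof.
  intros Hx [H|H]; [left; now apply ln_increasing|right; now rewrite H].
Qed.

(** Bernoulli's inequality bounds [1 + b p] by [(1 + p)^b], and [(1 - p) (1 + p) <= 1]. *)
Lemma geometric_decay (p : R) (b : nat) : 0 < p <= 1 ->
  (1 - p)^b * (1 + INR b * p) <= 1.
Proof.
  intros Hp.
  apply Rle_trans with ((1 - p)^b * (1 + p)^b).
  - apply Rmult_le_compat_l; [apply pow_le; lra|]. apply poly. lra.
  - rewrite <- Rpow_mult_distr. apply Rle_trans with (1^b); [|rewrite pow1; lra].
    apply pow_incr. split; nra.
Qed.

(** Both terms of [miss_prob_le] are [O(1/r)]: among [64^r] trials of probability [32^-r] one
    expects [2^r >= r] successes, and [rho = 64^r] cancels the number of blocks in the Chebyshev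
    term. The bound [s0] makes this uniform in [alpha]. *)
Lemma miss_prob_small (a : nat -> R) (sigma s0 u : R) (M r : nat) :
  0 < s0 <= sigma -> (forall m, sigma <= Rabs (a m) <= 1) ->
  (1 <= M <= r)%nat -> Rabs u <= INR M ->
  miss_prob a sigma r (64^r) (64^r) M u <= (1 + 200 / s0^2) / INR r.
Proof.
  intros Hs Ha HM Hu.
  assert (HM1 : 1 <= INR M) by (apply (le_INR 1); lia).
  assert (HMr : INR M <= INR r) by (apply le_INR; lia).
  assert (H64 : (1 <= 64^r)%nat) by (apply INR_le; rewrite INR_64_pow; apply pow_R1_Rle; lra).
  assert (Hr64 : INR r <= 64^r) by (apply INR_le_pow; lra).
  eapply Rle_trans; [apply miss_prob_le; try assumption; try lia; try lra; apply Ha|].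
  rewrite INR_64_pow. set (B := 64^r) in *.
  assert (HB : 0 < B) by (apply pow_lt; lra).
  assert (H1 : (1 - (/ 32)^r)^(64^r) <= / INR r).
  { assert (Hp : 0 < (/ 32)^r <= 1).
    { split; [apply pow_lt; lra|]. rewrite <- (pow1 r). apply pow_incr. lra. }
    pose proof (geometric_decay ((/ 32)^r) (64^r) Hp) as H.
    rewrite INR_64_pow, <- Rpow_mult_distr in H.
    replace (64 * / 32) with 2 in H by lra.
    assert (INR r <= 2^r) by (apply INR_le_pow; lra).
    assert (0 <= (1 - (/ 32)^r)^(64^r)) by (apply pow_le; lra).
    apply Rmult_le_reg_r with (INR r); [lra|]. rewrite Rinv_l by lra.
    eapply Rle_trans; [|exact H]. apply Rmult_le_compat_l; lra. }
  assert (H2 : u^2 / INR M <= B).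
  { apply Rle_trans with (INR M); [|lra].
    apply Rmult_le_reg_r with (INR M); [lra|].
    unfold Rdiv. rewrite Rmult_assoc, Rinv_l by lra.
    pose proof (Rabs_pos u). rewrite <- (pow2_abs u). nra. }
  assert (H3 : 100 / (sigma^2 * INR r^2 * B) * (u^2 / INR M + B)
               <= 200 / s0^2 / INR r).
  { assert (Hden : 0 < s0^2 * INR r * B).
    { apply Rmult_lt_0_compat; [|lra]. apply Rmult_lt_0_compat; [|lra]. nra. }
    apply Rle_trans with (100 / (s0^2 * INR r * B) * (B + B)).
    - apply Rmult_le_compat.
      + apply Rmult_le_pos; [lra|]. apply Rlt_le, Rinv_0_lt_compat.
        apply Rmult_lt_0_compat; [|lra]. apply Rmult_lt_0_compat; apply pow_lt; lra.
      + apply Rplus_le_le_0_compat; [|lra].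
        apply Rmult_le_pos; [apply pow2_ge_0|]. apply Rlt_le, Rinv_0_lt_compat. lra.
      + apply Rmult_le_compat_l; [lra|]. apply Rinv_le_contravar; [assumption|].
        apply Rmult_le_compat_r; [lra|].
        apply Rmult_le_compat; [nra|lra| |nra].
        apply pow_incr. lra.
      + lra.
    - right. field. lra. }
  replace ((1 + 200 / s0^2) / INR r) with (/ INR r + 200 / s0^2 / INR r) by (field; lra).
  lra.
Qed.

(** By [INR_final], [ln y <= r + r 64^(2r)], which is at most [16384^r <= exp (16 r)]. *)
Lemma loglog_final (r M y : nat) : (1 <= M <= r)%nat ->
  (2 <= y <= final r (64^r) (64^r) M)%nat -> ln (ln (INR y)) <= 16 * INR r.
Proof.
  intros HM Hy.
  assert (HM1 : 1 <= INR M) by (apply (le_INR 1); lia).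
  assert (HMr : INR M <= INR r) by (apply le_INR; lia).
  assert (Hy2 : 2 <= INR y) by (apply (le_INR 2); lia).
  assert (Hyf : INR y <= INR (final r (64^r) (64^r) M)) by (apply le_INR; lia).
  rewrite INR_final, INR_64_pow in Hyf.
  assert (HB : 1 <= 64^r) by (apply pow_R1_Rle; lra).
  assert (Hq : 1 < 1 + INR r * 64^r) by nra.
  assert (Hln1 : forall z, 0 < z -> ln (1 + z) <= z).
  { intros z Hz. rewrite <- (ln_exp z) at 2. apply Rlt_le, ln_increasing; [lra|].
    apply exp_ineq1. lra. }
  assert (HlnM : ln (INR M) <= INR r).
  { replace (INR M) with (1 + (INR M - 1)) by ring.
    destruct (Req_dec (INR M) 1) as [E|E].
    - rewrite E. replace (1 + (1 - 1)) with 1 by ring. rewrite ln_1. lra.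
    - specialize (Hln1 (INR M - 1)). lra. }
  assert (Hlny : ln (INR y) <= INR r + 64^r * (INR r * 64^r)).
  { apply Rle_trans with (ln (INR M * (1 + INR r * 64^r)^(64^r))).
    - apply ln_le; lra.
    - rewrite ln_mult, ln_pow by (try apply pow_lt; lra). rewrite INR_64_pow.
      apply Rplus_le_compat; [assumption|]. apply Rmult_le_compat_l; [lra|].
      apply Hln1. nra. }
  assert (Hpos : 0 < ln (INR y)) by (rewrite <- ln_1; apply ln_increasing; lra).
  rewrite <- (ln_exp (16 * INR r)). apply ln_le; [assumption|].
  eapply Rle_trans; [exact Hlny|].
  assert (Hr2 : INR r <= 2^r) by (apply INR_le_pow; lra).
  assert (Hexp : 16384^r <= exp (16 * INR r)).
  { rewrite (Rmult_comm 16), exp_INR_mult. apply pow_incr. split; [lra|].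
    apply Rle_trans with (exp 1 ^ 16).
    - apply Rle_trans with (2^16); [lra|]. apply pow_incr.
      pose proof (exp_ineq1 1). lra.
    - rewrite <- exp_INR_mult. simpl INR. apply Req_le. f_equal. lra. }
  eapply Rle_trans; [|exact Hexp].
  (* One factor [2^r] absorbs [r], the other the factor 2 from adding the two terms. *)
  replace 16384 with (64 * 64 * (2 * 2)) by lra.
  rewrite !Rpow_mult_distr.
  assert (H2r : 2 <= 2^r).
  { replace 2 with (2^1) at 1 by lra. apply Rle_pow; [lra|lia]. }
  assert (INR r <= INR r * (64^r * 64^r)) by nra.
  assert (0 <= 64^r * 64^r) by nra.
  assert (INR r * (64^r * 64^r) <= 2^r * (64^r * 64^r)) by (apply Rmult_le_compat_r; lra).
  assert (2 * (2^r * (64^r * 64^r)) <= 2^r * (2^r * (64^r * 64^r))) by (apply Rmult_le_compat_r; nra).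
  lra.
Qed.

(** * Beatty sequences *)

Definition coef (alpha : R) (m : nat) : R := ind (in_beatty alpha m) - / alpha.

Definition sig (alpha : R) : R := / alpha * (1 - / alpha).

(** The constant is [240 = 60 * 2 * 2]: 60 from [level_scale], one factor 2 for the loss in moving
    from a grid point to [alpha], one for comparing [sig] at the two points. *)
Definition hit (alpha : R) (f : nat -> R) (x : nat) : Prop :=
  sig alpha / 240 * (sqrt (INR x) * sqrt (ln (ln (INR x)))) <= walk (coef alpha) f x.

Lemma inv_bounds (alpha : R) : 1 < alpha -> 0 < / alpha < 1.
Proof.
  intros H. split; [apply Rinv_0_lt_compat; lra|].
  rewrite <- Rinv_1. apply Rinv_lt_contravar; lra.
Qed.

Lemma sig_pos (alpha : R) : 1 < alpha -> 0 < sig alpha.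
Proof. intros H. pose proof (inv_bounds alpha H). unfold sig. nra. Qed.

Lemma coef_bounds (alpha : R) (m : nat) :
  1 < alpha -> sig alpha <= Rabs (coef alpha m) <= 1.
Proof.
  intros H. pose proof (inv_bounds alpha H). unfold sig, coef, ind.
  destruct excluded_middle_informative.
  - rewrite Rabs_right by lra. nra.
  - rewrite Rabs_left by lra. nra.
Qed.

Lemma S_alpha_walk (alpha : R) (f : nat -> R) (x : nat) :
  S_alpha alpha f x - / alpha * S_full f x = walk (coef alpha) f x.
Proof.
  unfold S_alpha, S_full, walk, coef.
  induction x as [|x IH]; cbn [sum_to]; [ring|]. rewrite <- IH. ring.
Qed.

Lemma norm2_signs (f : nat -> R) (x : nat) :
  signs f -> norm2_upto f x = sqrt (INR x).
Proof.
  intros Hf. unfold norm2_upto. f_equal.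
  induction x as [|x IH]; [reflexivity|].
  rewrite S_INR. cbn [sum_to]. rewrite IH. destruct (Hf (S x)) as [-> | ->]; ring.
Qed.

Lemma in_beatty_bounds (alpha : R) (m : nat) :
  in_beatty alpha m <->
  exists n, (1 <= n)%nat /\ INR m <= INR n * alpha < INR m + 1.
Proof.
  split; intros (n & Hn & H); exists n; (split; [assumption|]).
  - pose proof (base_Int_part (INR n * alpha)) as [H1 H2].
    rewrite H, <- INR_IZR_INZ in H1, H2. lra.
  - symmetry. apply Int_part_spec. rewrite <- INR_IZR_INZ. lra.
Qed.

(** Membership of [m] can change only when the parameter crosses some [m / n] or [(m + 1) / n], and
    no such fraction lies in [[u, alpha]]. The numerator [m + 1] is why the range extends to
    [S X]. *)
Lemma in_beatty_locally_constant (u alpha h : R) (X m : nat) :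
  1 <= u <= alpha -> alpha <= u + h -> (m <= X)%nat ->
  (forall q n, (q <= S X)%nat -> (1 <= n <= S X)%nat ->
     h < Rabs (alpha - INR q / INR n)) ->
  in_beatty alpha m <-> in_beatty u m.
Proof.
  intros Hu Hh Hm Hfar.
  assert (Hbreak : forall q n, (q <= S X)%nat -> (1 <= n <= S X)%nat ->
            ~ (INR n * u <= INR q <= INR n * alpha)).
  { intros q n Hq Hn [H1 H2]. specialize (Hfar q n Hq Hn).
    assert (Hn' : 1 <= INR n) by (apply (le_INR 1); lia).
    assert (E : INR q = INR n * (INR q / INR n)) by (field; lra).
    set (z := INR q / INR n) in *. rewrite E in H1, H2.
    apply Rmult_le_reg_l in H1; [|lra]. apply Rmult_le_reg_l in H2; [|lra].
    rewrite Rabs_right in Hfar; lra. }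
  assert (Hsize : forall n v, 1 <= v -> INR n * v < INR m + 1 -> (n <= S X)%nat).
  { intros n v Hv H. assert (INR n <= INR n * v) by (pose proof (pos_INR n); nra).
    rewrite <- S_INR in H. apply Nat.le_trans with (S m); [|lia].
    apply INR_le. lra. }
  rewrite !in_beatty_bounds.
  split; intros (n & Hn & H1 & H2); exists n; (split; [assumption|]);
    assert (Hn' : 1 <= INR n) by (apply (le_INR 1); lia).
  - split; [|nra].
    destruct (Rle_lt_dec (INR m) (INR n * u)) as [H|H]; [assumption|exfalso].
    apply (Hbreak m n); [lia| |lra]. split; [lia|]. apply (Hsize n alpha); lra.
  - split; [nra|].
    destruct (Rlt_le_dec (INR n * alpha) (INR m + 1)) as [H|H]; [assumption|exfalso].
    rewrite <- S_INR in *.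
    apply (Hbreak (S m) n); [lia| |lra]. split; [lia|].
    apply (Hsize n u); lra.
Qed.

Lemma inv_lipschitz (u v : R) : 1 <= u <= v -> 0 <= / u - / v <= v - u.
Proof.
  intros H. replace (/ u - / v) with ((v - u) * (/ u * / v)) by (field; lra).
  assert (0 < / u <= 1).
  { split; [apply Rinv_0_lt_compat; lra|]. rewrite <- Rinv_1. apply Rinv_le_contravar; lra. }
  assert (0 < / v <= 1).
  { split; [apply Rinv_0_lt_compat; lra|]. rewrite <- Rinv_1. apply Rinv_le_contravar; lra. }
  assert (0 <= / u * / v <= 1) by nra. nra.
Qed.

(** With equal indicators only the term [1 / alpha] moves, by at most [h] per step. *)
Lemma walk_coef_perturb (u alpha h : R) (f : nat -> R) (x : nat) :
  1 <= u <= alpha -> alpha <= u + h -> signs f ->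
  (forall m, (m <= x)%nat -> in_beatty alpha m <-> in_beatty u m) ->
  walk (coef u) f x - h * INR x <= walk (coef alpha) f x.
Proof.
  intros Hu Hh Hf Hc. unfold walk.
  induction x as [|x IH]; [simpl; lra|].
  cbn [sum_to]. rewrite S_INR.
  specialize (IH (fun m Hm => Hc m (le_S _ _ Hm))).
  assert (E : ind (in_beatty alpha (S x)) = ind (in_beatty u (S x))).
  { specialize (Hc (S x) (le_n _)). unfold ind.
    do 2 destruct excluded_middle_informative; tauto. }
  pose proof (inv_lipschitz u alpha Hu).
  unfold coef at 2 4. rewrite E.
  destruct (Hf (S x)) as [-> | ->]; lra.
Qed.

(** With [n = 64^r y] one has [x <= 2 r n], so the product of roots is at most
    [sqrt (32 r^2 n) <= 6 r sqrt n]. *)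
Lemma level_scale (sigma : R) (r y : nat) : (1 <= y)%nat -> (1 <= r)%nat ->
  0 < sigma -> let x := next r (64^r) y in
  ln (ln (INR x)) <= 16 * INR r ->
  sigma / 60 * (sqrt (INR x) * sqrt (ln (ln (INR x)))) <= level sigma r (64^r) y.
Proof.
  intros Hy Hr Hs x Hx. unfold level.
  assert (Hr' : 1 <= INR r) by (apply (le_INR 1); lia).
  assert (Hy' : 1 <= INR y) by (apply (le_INR 1); lia).
  set (n := (64^r * y)%nat).
  assert (Hyn : INR y <= INR n).
  { unfold n. rewrite mult_INR, INR_64_pow.
    assert (1 <= 64^r) by (apply pow_R1_Rle; lra). nra. }
  assert (Hxn : INR x <= 2 * INR r * INR n).
  { unfold x, next. fold n. rewrite plus_INR, mult_INR. nra. }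
  assert (H : sqrt (INR x) * sqrt (ln (ln (INR x))) <= 6 * INR r * sqrt (INR n)).
  { apply Rle_trans with (sqrt (2 * INR r * INR n) * sqrt (16 * INR r)).
    - apply Rmult_le_compat; try apply sqrt_pos; now apply sqrt_le_1_alt.
    - rewrite <- (sqrt_pow2 (6 * INR r)) by lra.
      rewrite <- !sqrt_mult by nra. apply sqrt_le_1_alt.
      assert (0 <= INR r * INR r * INR n) by (apply Rmult_le_pos; nra). nra. }
  apply Rmult_le_compat_l with (r := sigma / 60) in H; lra.
Qed.

(** * Finite interval families and one stage of the construction *)

Definition total (l : list (R * R)) : R := rsum (map (fun p => snd p - fst p) l).

Definition covered (l : list (R * R)) (t : R) : Prop :=
  exists p, In p l /\ fst p <= t <= snd p.

Lemma rsum_app (l1 l2 : list R) : rsum (l1 ++ l2) = rsum l1 + rsum l2.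
Proof. induction l1 as [|y l1 IH]; simpl; lra. Qed.

Lemma rsum_map_le {A : Type} (g : A -> R) (c : R) (l : list A) :
  (forall i, In i l -> g i <= c) -> rsum (map g l) <= INR (length l) * c.
Proof.
  induction l as [|i l IH]; intros H; [simpl; lra|].
  cbn [length map rsum fold_right]. rewrite S_INR.
  assert (rsum (map g l) <= INR (length l) * c) by (apply IH; intros; apply H; now right).
  assert (g i <= c) by (apply H; now left).
  unfold rsum in *. lra.
Qed.

Lemma exists_INR_ge (z : R) : exists n, (1 <= n)%nat /\ z <= INR n.
Proof.
  exists (S (Z.to_nat (up z))). split; [lia|].
  rewrite S_INR, INR_IZR_INZ. pose proof (archimed z) as [H _].
  assert (IZR (up z) <= IZR (Z.of_nat (Z.to_nat (up z)))) by (apply IZR_le; lia). lra.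
Qed.

Lemma exists_cell (lo h t : R) (K : nat) : lo <= t <= lo + INR K * h -> (1 <= K)%nat ->
  exists i, (i < K)%nat /\ lo + INR i * h <= t <= lo + INR i * h + h.
Proof.
  induction K as [|K IH]; intros Ht HK; [lia|].
  rewrite S_INR in Ht.
  destruct (Rle_lt_dec (lo + INR K * h) t) as [H|H].
  - exists K. split; [lia|lra].
  - destruct (Nat.eq_dec K 0) as [->|HK0]; [simpl in H; lra|].
    destruct IH as (i & Hi & Hit); [lra|lia|]. exists i. split; [lia|assumption].
Qed.

(* The average over the sign patterns on [(M, X]] of the total length of the
   cells whose left end point is missed is small, so some pattern makes that
   length small; intervals around the fractions [q / n] take care of the cells
   on which some Beatty indicator jumps. *)
Lemma stage (lo hi eps : R) (M : nat) (f : nat -> R) :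
  1 < lo < hi -> 0 < eps -> (1 <= M)%nat -> signs f ->
  exists (X : nat) (f' : nat -> R) (l : list (R * R)),
    (M < X)%nat /\ signs f' /\ agree M f f' /\ l <> nil /\
    (forall p, In p l -> fst p <= snd p) /\ total l <= eps /\
    forall alpha, lo <= alpha <= hi ->
      covered l alpha \/ exists x, (M <= x <= X)%nat /\ hit alpha f' x.
Proof.
  intros Hlh Heps HM Hf.
  set (s0 := / hi * (1 - / lo)).
  assert (Hilo : 0 < / lo < 1) by (apply inv_bounds; lra).
  assert (Hihi : 0 < / hi < 1) by (apply inv_bounds; lra).
  assert (Hs0 : 0 < s0) by (unfold s0; nra).
  assert (Hsig : forall u, lo <= u <= hi -> s0 <= sig u).
  { intros u Hu. unfold s0, sig. apply Rmult_le_compat; try lra.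
    - apply Rinv_le_contravar; lra.
    - assert (/ u <= / lo) by (apply Rinv_le_contravar; lra). lra. }
  assert (Hs2 : 0 < 200 / s0^2) by (apply Rdiv_lt_0_compat; [lra|now apply pow_lt]).
  destruct (exists_INR_ge ((hi - lo) * (1 + 200 / s0^2) * (2 / eps))) as (r0 & _ & Hr0).
  (* [r0] brings the mean missed length below [eps / 2]; adding [M] gives [M <= r], as
     [miss_prob_small] requires. *)
  set (r := (r0 + M)%nat).
  assert (Hr : (1 <= r)%nat) by (unfold r; lia).
  assert (Hr1 : 1 <= INR r) by (apply (le_INR 1); lia).
  assert (Hr' : (hi - lo) * ((1 + 200 / s0^2) / INR r) <= eps / 2).
  { assert (Hrr : INR r0 <= INR r) by (apply le_INR; unfold r; lia).
    apply Rmult_le_reg_r with (INR r * (2 / eps)).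
    - apply Rmult_lt_0_compat; [lra|]. apply Rdiv_lt_0_compat; lra.
    - replace (eps / 2 * (INR r * (2 / eps))) with (INR r) by (field; lra).
      eapply Rle_trans; [|exact Hrr]. eapply Rle_trans; [|exact Hr0].
      right. field. lra. }
  set (B := (64^r)%nat).
  set (X := final r B B M).
  assert (HXM : (M <= X)%nat) by apply final_ge.
  assert (HX1 : 1 <= INR X) by (apply (le_INR 1); lia).
  set (L := list_prod (seq 0 (S (S X))) (seq 1 (S X))).
  (* The first summand makes the perturbation [h X] at most [s0 / 20], half the least possible
     level; the second keeps the intervals around the fractions within [eps / 2]. *)
  destruct (exists_INR_ge ((hi - lo) * (20 * INR X / s0 + 4 * INR (length L) / eps)))
    as (K & HK & HKh).
  assert (HK1 : 1 <= INR K) by (apply (le_INR 1); lia).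
  set (h := (hi - lo) / INR K).
  assert (Hh0 : 0 < h) by (apply Rdiv_lt_0_compat; lra).
  assert (HKhe : INR K * h = hi - lo) by (unfold h; field; lra).
  assert (HL0 : 0 <= INR (length L)) by apply pos_INR.
  assert (Hh' : h * (20 * INR X / s0 + 4 * INR (length L) / eps) <= 1).
  { apply Rmult_le_reg_l with (INR K); [lra|]. rewrite <- Rmult_assoc, HKhe. lra. }
  assert (HA : 0 <= 20 * INR X / s0) by (apply Rlt_le, Rdiv_lt_0_compat; lra).
  assert (HB : 0 <= 4 * INR (length L) / eps).
  { apply Rmult_le_pos; [lra|]. apply Rlt_le, Rinv_0_lt_compat. lra. }
  assert (HhX : h * INR X <= s0 / 20).
  { assert (H : h * (20 * INR X / s0) <= 1) by nra.
    apply Rmult_le_compat_r with (r := s0 / 20) in H; [|lra].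
    replace (h * (20 * INR X / s0) * (s0 / 20)) with (h * INR X) in H by (field; lra). lra. }
  assert (HhL : INR (length L) * (2 * h) <= eps / 2).
  { assert (H : h * (4 * INR (length L) / eps) <= 1) by nra.
    apply Rmult_le_compat_r with (r := eps / 2) in H; [|lra].
    replace (h * (4 * INR (length L) / eps) * (eps / 2)) with (INR (length L) * (2 * h)) in H
      by (field; lra). lra. }
  set (pt := fun i => lo + INR i * h).
  assert (Hpt : forall i, (i < K)%nat -> lo <= pt i <= hi).
  { intros i Hi. unfold pt. pose proof (pos_INR i).
    assert (INR i <= INR K) by (apply le_INR; lia). nra. }
  (* A cell counts with its full length if its left end point is missed and shrinks to a point
     otherwise. *)
  set (len := fun i f' => h * miss (coef (pt i)) (sig (pt i)) r B B M f').
  destruct (avg_attained (X - M) M (fun f' => rsum (map (fun i => len i f') (seq 0 K))) f Hf)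
    as (f' & Hf' & Hag & Hle).
  assert (Hfail : rsum (map (fun i => len i f') (seq 0 K)) <= eps / 2).
  { eapply Rle_trans; [exact Hle|]. rewrite (avg_rsum (seq 0 K) len).
    eapply Rle_trans; [|exact Hr'].
    replace ((hi - lo) * ((1 + 200 / s0^2) / INR r))
      with (INR (length (seq 0 K)) * (h * ((1 + 200 / s0^2) / INR r)))
      by (rewrite length_seq, <- HKhe; ring).
    apply rsum_map_le. intros i Hi. apply in_seq in Hi.
    specialize (Hpt i ltac:(lia)).
    unfold len. rewrite avg_scal. apply Rmult_le_compat_l; [lra|].
    unfold X. rewrite avg_miss.
    apply miss_prob_small.
    - split; [assumption|now apply Hsig].
    - intros m. apply coef_bounds. lra.
    - unfold r. lia.
    - apply walk_abs_le; [|assumption]. intros m. apply coef_bounds. lra. }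
  set (l1 := map (fun i => (pt i, pt i + len i f')) (seq 0 K)).
  set (l2 := map (fun qn => (INR (fst qn) / INR (snd qn) - h,
                             INR (fst qn) / INR (snd qn) + h)) L).
  (* [S X] makes the inequality with [M] strict, since [final_ge] gives only [M <= X]. *)
  exists (S X), f', (l1 ++ l2).
  repeat split.
  - lia.
  - assumption.
  - assumption.
  - unfold l1. destruct K; [lia|]. discriminate.
  - intros p Hp. apply in_app_or in Hp as [Hp|Hp]; apply in_map_iff in Hp as (z & <- & _); simpl.
    + assert (0 <= len z f') by (apply Rmult_le_pos; [lra|apply miss_nonneg]). lra.
    + lra.
  - unfold total. rewrite map_app, rsum_app. unfold l1, l2. rewrite !map_map. cbn [fst snd].
    assert (E1 : rsum (map (fun i => pt i + len i f' - pt i) (seq 0 K)) <= eps / 2).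
    { erewrite map_ext; [exact Hfail|]. intros i. simpl. ring. }
    assert (E2 : rsum (map (fun x => INR (fst x) / INR (snd x) + h
                     - (INR (fst x) / INR (snd x) - h)) L) <= INR (length L) * (2 * h)).
    { apply rsum_map_le. intros. lra. }
    lra.
  - intros alpha Halpha.
    destruct (classic (exists q n, (q <= S X)%nat /\ (1 <= n <= S X)%nat /\
                Rabs (alpha - INR q / INR n) <= h)) as [(q & n & Hq & Hn & Hd)|Hfar].
    { left. exists (INR q / INR n - h, INR q / INR n + h). split.
      - apply in_or_app. right.
        apply (in_map (fun qn => (INR (fst qn) / INR (snd qn) - h,
                             INR (fst qn) / INR (snd qn) + h)) L (q, n)).
        apply in_prod; apply in_seq; lia.
      - simpl. pose proof (Rle_abs (alpha - INR q / INR n)).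
        pose proof (Rle_abs (- (alpha - INR q / INR n))) as Hneg.
        rewrite Rabs_Ropp in Hneg. lra. }
    destruct (exists_cell lo h alpha K) as (i & Hi & Hcell); [lra|assumption|].
    fold (pt i) in Hcell. specialize (Hpt i Hi).
    destruct (miss_cases (coef (pt i)) (sig (pt i)) r B B M f' HM)
      as [E|(y & Hy & Hyf & Hlev)].
    { left. exists (pt i, pt i + len i f'). split.
      - apply in_or_app. left.
        apply (in_map (fun i => (pt i, pt i + len i f'))). apply in_seq. lia.
      - simpl. unfold len. rewrite E. lra. }
    right. set (x := next r B y) in *. fold X in Hyf.
    assert (HB64 : (1 <= B)%nat).
    { apply INR_le. unfold B. rewrite INR_64_pow. apply pow_R1_Rle. lra. }
    assert (HBy : (1 <= B * y)%nat) by (apply Nat.mul_pos_pos; lia).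
    assert (Hx : (2 <= x)%nat).
    { pose proof (Nat.mul_pos_pos r (B * y) Hr HBy). unfold x, next. lia. }
    exists x. split; [unfold x, next in *; lia|]. unfold hit.
    assert (Hper : walk (coef (pt i)) f' x - h * INR x <= walk (coef alpha) f' x).
    { apply walk_coef_perturb; try assumption; try lra.
      intros m Hm. apply (in_beatty_locally_constant (pt i) alpha h X m); try lra; [lia|].
      intros q n Hq Hn. apply Rnot_le_lt. intros Hc. apply Hfar. now exists q, n. }
    assert (HxX : h * INR x <= h * INR X) by (apply Rmult_le_compat_l; [lra|now apply le_INR]).
    pose proof (Hsig (pt i) Hpt) as Hsi.
    assert (Hlev1 : sig (pt i) / 10 <= level (sig (pt i)) r B y).
    { unfold level.
      assert (1 <= sqrt (INR (B * y))).
      { rewrite <- sqrt_1. apply sqrt_le_1_alt. now apply (le_INR 1). }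
      assert (1 <= INR r * sqrt (INR (B * y))) by nra.
      assert (sig (pt i) * 1 <= sig (pt i) * (INR r * sqrt (INR (B * y))))
        by (apply Rmult_le_compat_l; lra). lra. }
    assert (Hsc : sig (pt i) / 60 * (sqrt (INR x) * sqrt (ln (ln (INR x))))
                  <= level (sig (pt i)) r B y).
    { apply level_scale; [lia|assumption|lra|].
      apply (loglog_final r M); [unfold r; lia|]. fold B X x. lia. }
    assert (Hsa : sig alpha <= 2 * sig (pt i)).
    { pose proof (inv_lipschitz (pt i) alpha ltac:(lra)).
      pose proof (inv_bounds alpha ltac:(lra)). pose proof (inv_bounds (pt i) ltac:(lra)).
      assert (h <= h * INR X) by nra.
      assert (sig alpha <= sig (pt i) + h) by (unfold sig; nra). lra. }
    set (Q := sqrt (INR x) * sqrt (ln (ln (INR x)))) in *.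
    assert (HQ : 0 <= Q) by (apply Rmult_le_pos; apply sqrt_pos).
    assert (sig alpha * Q <= 2 * sig (pt i) * Q) by (apply Rmult_le_compat_r; assumption).
    lra.
Qed.

(** * Null sets and the inductive construction *)

Lemma total_app (l1 l2 : list (R * R)) : total (l1 ++ l2) = total l1 + total l2.
Proof. unfold total. now rewrite map_app, rsum_app. Qed.

Lemma total_nonneg (l : list (R * R)) :
  (forall p, In p l -> fst p <= snd p) -> 0 <= total l.
Proof.
  induction l as [|p l IH]; intros H; unfold total; simpl; [lra|].
  assert (0 <= total l) by (apply IH; intros; apply H; now right).
  assert (fst p <= snd p) by (apply H; now left).
  unfold total, rsum in *. lra.
Qed.

Lemma sum_nth_le_total (l : list (R * R)) : forall N,
  (forall p, In p l -> fst p <= snd p) -> (N < length l)%nat ->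
  sum_f_R0 (fun n => snd (nth n l (0, 0)) - fst (nth n l (0, 0))) N <= total l.
Proof.
  induction l as [|p l IH]; intros N H HN; [simpl in HN; lia|].
  assert (H' : forall q, In q l -> fst q <= snd q) by (intros; apply H; now right).
  change (total (p :: l)) with (snd p - fst p + total l).
  destruct N as [|N].
  - simpl. pose proof (total_nonneg l H'). lra.
  - rewrite decomp_sum by lia. simpl pred. cbn [nth].
    specialize (IH N H'). simpl in HN. specialize (IH ltac:(lia)). lra.
Qed.

Section Concatenation.

Variable l : nat -> list (R * R).
Hypothesis l_nonempty : forall k, l k <> nil.
Hypothesis l_ordered : forall k p, In p (l k) -> fst p <= snd p.

Fixpoint upto (n : nat) : list (R * R) :=
  match n with
  | O => l 0
  | S k => upto k ++ l (S k)
  end.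

Lemma upto_length (n : nat) : (n < length (upto n))%nat.
Proof.
  assert (H : forall k, (1 <= length (l k))%nat).
  { intros k. specialize (l_nonempty k). destruct (l k); [easy|simpl; lia]. }
  induction n as [|n IH]; simpl; [exact (H 0%nat)|].
  rewrite length_app. specialize (H (S n)). lia.
Qed.

Lemma upto_nth (n k j : nat) : (n <= k)%nat -> (j < length (upto n))%nat ->
  nth j (upto k) (0, 0) = nth j (upto n) (0, 0).
Proof.
  intros Hnk Hj.
  assert (H : (j < length (upto k))%nat /\ nth j (upto k) (0, 0) = nth j (upto n) (0, 0)).
  { induction Hnk as [|k Hnk [IH1 IH2]]; [auto|]. simpl. rewrite length_app.
    split; [lia|]. now rewrite app_nth1. }
  apply H.
Qed.

Lemma upto_ordered (n : nat) : forall p, In p (upto n) -> fst p <= snd p.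
Proof.
  induction n as [|n IH]; simpl; intros p Hp; [now apply (l_ordered 0)|].
  apply in_app_or in Hp as [Hp|Hp]; [now apply IH|now apply (l_ordered (S n))].
Qed.

Lemma upto_in (n : nat) (p : R * R) : In p (l n) -> In p (upto n).
Proof. destruct n; simpl; [easy|]. intros H. apply in_or_app. now right. Qed.

(** Enumerate the concatenated lists by taking entry [n] of [upto n]: nonempty lists give [upto n]
    more than [n] entries, and later lists do not alter earlier entries. *)
Lemma countable_cover (E : R -> Prop) (eps : R) :
  (forall n, total (upto n) <= eps) ->
  (forall t, E t -> exists k, covered (l k) t) ->
  exists a b : nat -> R,
    (forall n, a n <= b n) /\
    (forall t, E t -> exists n, a n <= t <= b n) /\
    (forall N, sum_f_R0 (fun n => b n - a n) N <= eps).
Proof.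
  intros Htot Hcov.
  exists (fun n => fst (nth n (upto n) (0, 0))), (fun n => snd (nth n (upto n) (0, 0))).
  repeat split.
  - intros n. apply (upto_ordered n), nth_In, upto_length.
  - intros t Ht. destruct (Hcov t Ht) as (k & p & Hp & Hpt).
    apply upto_in in Hp. apply (In_nth _ _ (0, 0)) in Hp as (j & Hj & <-).
    exists j.
    replace (nth j (upto j) (0, 0)) with (nth j (upto k) (0, 0)); [assumption|].
    destruct (Nat.le_ge_cases j k) as [H|H].
    + apply upto_nth; [assumption|apply upto_length].
    + symmetry. now apply upto_nth.
  - intros N. eapply Rle_trans; [|apply (Htot N)].
    eapply Rle_trans; [|apply (sum_nth_le_total (upto N) N)];
      [|apply upto_ordered|apply upto_length].
    right. apply sum_eq. intros n Hn.
    now rewrite (upto_nth n N n Hn (upto_length n)).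
Qed.

End Concatenation.

Lemma dependent_choice {A : Type} (I : A -> Prop) (Q : nat -> A -> A -> Prop) (x0 : A) :
  I x0 -> (forall k x, I x -> exists y, I y /\ Q k x y) ->
  exists s : nat -> A, s 0%nat = x0 /\ forall k, I (s k) /\ Q k (s k) (s (S k)).
Proof.
  intros H0 Hstep.
  set (s := nat_rect (fun _ => A) x0
              (fun k x => epsilon (inhabits x) (fun y => I y /\ Q k x y))).
  assert (HI : forall k, I (s k) -> I (s (S k)) /\ Q k (s k) (s (S k))).
  { intros k Hk. exact (epsilon_spec (inhabits (s k)) _ (Hstep k (s k) Hk)). }
  assert (Hall : forall k, I (s k)).
  { induction k as [|k IH]; [exact H0|now apply HI]. }
  exists s. split; [reflexivity|]. intros k. split; [apply Hall|now apply HI].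
Qed.

(** The bound is strengthened to the partial geometric sum so that the induction telescopes. *)
Lemma total_upto_geometric (l : nat -> list (R * R)) (k0 : nat) :
  (forall k, total (l k) <= (/ 2)^S k) ->
  forall n, total (upto (fun k => l (k0 + k)%nat) n) <= (/ 2)^k0.
Proof.
  intros Hl n.
  enough (total (upto (fun k => l (k0 + k)%nat) n) <= (/ 2)^k0 - (/ 2)^(k0 + S n)).
  { assert (0 < (/ 2)^(k0 + S n)) by (apply pow_lt; lra). lra. }
  induction n as [|n IH].
  - cbn [upto]. rewrite Nat.add_0_r. eapply Rle_trans; [apply Hl|].
    rewrite Nat.add_1_r. simpl. lra.
  - cbn [upto]. rewrite total_app. specialize (Hl (k0 + S n)%nat).
    replace (k0 + S (S n))%nat with (S (k0 + S n)) by lia. simpl pow in *. lra.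
Qed.

Theorem mainTheorem3 :
  exists f0 : nat -> R,
    (forall m : nat, (1 <= m)%nat -> f0 m = 1 \/ f0 m = -1) /\
    null_set (fun alpha : R =>
      alpha > 1 /\
      ~ (exists c : R, c > 0 /\
           forall N : nat, exists x : nat, (N <= x)%nat /\
             S_alpha alpha f0 x - / alpha * S_full f0 x
               >= c * norm2_upto f0 x * sqrt (ln (ln (INR x))))).
Proof.
  set (lo := fun k => 1 + / (INR k + 2)). set (hi := fun k => INR k + 2).
  (* A state holds the position reached, the current pattern and the exceptional intervals of the
     stage just completed. *)
  destruct (dependent_choice
    (fun x : nat * (nat -> R) * list (R * R) => (1 <= fst (fst x))%nat /\ signs (snd (fst x)))
    (fun k x y => (fst (fst x) < fst (fst y))%nat /\
       agree (fst (fst x)) (snd (fst x)) (snd (fst y)) /\ snd y <> nil /\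
       (forall p, In p (snd y) -> fst p <= snd p) /\ total (snd y) <= (/ 2)^S k /\
       forall alpha, lo k <= alpha <= hi k -> covered (snd y) alpha \/
         exists m, (fst (fst x) <= m <= fst (fst y))%nat /\ hit alpha (snd (fst y)) m)
    (1%nat, (fun _ => 1), nil)) as (s & Hs0 & Hs).
  { split; [simpl; lia|]. intros m. now left. }
  { intros k [[M f] l0] [HM Hf]. simpl in HM, Hf.
    assert (Hlh : 1 < lo k < hi k).
    { unfold lo, hi. pose proof (pos_INR k).
      assert (0 < / (INR k + 2)) by (apply Rinv_0_lt_compat; lra).
      assert (/ (INR k + 2) <= / 2) by (apply Rinv_le_contravar; lra). lra. }
    destruct (stage (lo k) (hi k) ((/ 2)^S k) M f Hlh)
      as (X & f' & l & H1 & H2 & H3 & H4 & H5 & H6 & H7);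
      [apply pow_lt; lra|assumption|assumption|].
    exists (X, f', l). simpl in *. repeat split; try assumption. lia. }
  set (pos := fun k => fst (fst (s k))). set (pat := fun k => snd (fst (s k))).
  assert (Hpos : forall k, (k < pos k)%nat).
  { induction k as [|k IH]; [unfold pos; rewrite Hs0; simpl; lia|].
    destruct (Hs k) as (_ & H & _). unfold pos in *. lia. }
  assert (Hpat : forall i j, (i <= j)%nat -> (pos i <= pos j)%nat /\ agree (pos i) (pat i) (pat j)).
  { intros i j Hij. induction Hij as [|j Hij [IH1 IH2]]; [split; [lia|easy]|].
    destruct (Hs j) as (_ & H1 & H2 & _). fold (pos j) (pos (S j)) in H1. split; [lia|].
    eapply agree_trans; [exact IH1|exact IH2|exact H2]. }
  (* The diagonal is the limit pattern: [m < pos m], so the value at [m] is final from stage [m]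
     on. *)
  set (f0 := fun m => pat m m).
  assert (Hsigns : signs f0) by (intros m; apply (Hs m)).
  assert (Hagree : forall k, agree (pos k) (pat k) f0).
  { intros k m Hm. unfold f0. destruct (Nat.le_ge_cases k m) as [H|H].
    - now apply (Hpat k m H).
    - symmetry. apply (Hpat m k H). specialize (Hpos m). lia. }
  exists f0. split; [intros m _; apply Hsigns|].
  intros eps Heps.
  destruct (pow_lt_1_zero (/ 2)) with (y := eps) as (k0 & Hk0);
    [rewrite Rabs_right; lra|assumption|].
  specialize (Hk0 k0 (le_n _)). rewrite Rabs_right in Hk0 by (apply Rle_ge, pow_le; lra).
  (* Only stages from [k0] on are used, with total length at most [(/ 2)^k0 < eps]; the intervals of
     stage [k] are stored in state [S k]. *)
  apply countable_cover with (l := fun k => snd (s (S (k0 + k)))).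
  - intros k. apply (Hs (k0 + k)%nat).
  - intros k. apply (Hs (k0 + k)%nat).
  - intros n. eapply Rle_trans; [|apply Rlt_le, Hk0].
    apply (total_upto_geometric (fun k => snd (s (S k)))). intros k. apply (Hs k).
  - intros alpha [Ha Hno].
    assert (Hfail : exists N, forall x, (N <= x)%nat -> ~ hit alpha f0 x).
    { apply NNPP. intros Hc. apply Hno. exists (sig alpha / 240). split.
      - pose proof (sig_pos alpha Ha). lra.
      - intros N. apply NNPP. intros Hx. apply Hc. exists N. intros x HNx Hhit.
        apply Hx. exists x. split; [assumption|].
        rewrite S_alpha_walk, norm2_signs by assumption.
        unfold hit in Hhit. lra. }
    destruct Hfail as (N & HN).
    (* From [k1] on, [alpha] lies in [[lo k, hi k]]. Adding [N] puts every hit of the stage beyond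
       [N], so [alpha] must be covered. *)
    destruct (exists_INR_ge (alpha + / (alpha - 1))) as (k1 & _ & Hk1).
    exists (k1 + N)%nat. set (k := (k0 + (k1 + N))%nat).
    assert (Hinv : 0 < / (alpha - 1)) by (apply Rinv_0_lt_compat; lra).
    assert (Hk : INR k1 <= INR k) by (apply le_INR; unfold k; lia).
    destruct (Hs k) as (_ & _ & _ & _ & _ & _ & Hcov).
    destruct (Hcov alpha) as [H|(x & Hx & Hhit)]; [|assumption|exfalso].
    + unfold lo, hi. split; [|lra].
      assert (/ (INR k + 2) <= / / (alpha - 1)) by (apply Rinv_le_contravar; lra).
      rewrite Rinv_inv in *. lra.
    + fold (pos k) (pos (S k)) (pat (S k)) in Hx, Hhit.
      apply (HN x); [specialize (Hpos k); unfold k in *; lia|].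
      unfold hit in *. now rewrite (walk_agree _ (pat (S k)) f0 x (pos (S k))) by (try apply Hagree; lia).
Qed.
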